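(* Let $G$ be an AH-algebra (the directed group of an e-ring $(R,E)$) with set of projections $P$, let $g\in G$, let $L:=L_g$ and $U:=U_g$ be the spectral lower and upper bounds of $g$, and let $(p_\lambda)_{\lambda\in\mathbb R}$ be the spectral resolution of $g$. Let $n\geq 1$ and suppose that $\lambda_0,\lambda_1,\dots,\lambda_n\in\mathbb R$ with $$\lambda_0<L<\lambda_1<\cdots<\lambda_{n-1}<U<\lambda_n$$ (for $n=1$ this reads $\lambda_0<L$ and $U<\lambda_1$), and let $\gamma_i\in\mathbb R$ with $\lambda_{i-1}\leq\gamma_i\leq\lambda_i$ for $i=1,2,\dots,n$. Define $u_i:=p_{\lambda_i}-p_{\lambda_{i-1}}$ for $i=1,2,\dots,n$, and let $\epsilon:=\max\{\lambda_i-\lambda_{i-1}: i=1,2,\dots,n\}$. Then $$u_1,u_2,\dots,u_n\in P\cap CC(g),\qquad \sum_{i=1}^n u_i=1,\qquad\text{and}\qquad \Big\|g-\sum_{i=1}^n\gamma_iu_i\Big\|\leq\epsilon .$$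
   Context: **e-rings.** An e-ring is a pair $(R,E)$ where $R$ is an associative ring with unity $1\neq 0$ and $E\subseteq R$ is a subset (elements called effects) such that $0,1\in E$; $e\in E\Rightarrow 1-e\in E$; and the set $E^{+}$ of all finite sums $e_1+\cdots+e_n$ with $e_i\in E$ satisfies, for all $a,b\in E^{+}$: (i) $-a\in E^{+}\Rightarrow a=0$; (ii) $1-a\in E^{+}\Rightarrow a\in E$; (iii) $ab=ba\Rightarrow ab\in E^{+}$; (iv) $aba\in E^{+}$; (v) $aba=0\Rightarrow ab=ba=0$; (vi) $(a-b)^2\in E^{+}$. The directed group of $(R,E)$ is $G:=E^{+}-E^{+}=\{a-b: a,b\in E^{+}\}$, a subgroup of the additive group of $R$, partially ordered by $g\leq h\Leftrightarrow h-g\in E^{+}$. The set of projections is $P:=\{p\in G: p=p^2\}$. Products of elements of $G$ are taken in $R$. **Commutants.** For $g,h\in G$, $gCh$ means $gh=hg$. For $A\subseteq G$, $C(A):=\{g\in G: gCa\ \forall a\in A\}$, $CC(A):=C(C(A))$, $CC(g):=CC(\{g\})$. **AH-algebra.** $G$ is an AH-algebra iff: (1) there is an effect $\frac12\in E$ with $\frac12+\frac12=1$; (2) quadratic annihilation (QA): for all $g,h\in G$, $gh^2g=0\Rightarrow gh=hg=0$; (3) commutative Vigier (CV) property: every ascending sequence $g_1\leq g_2\leq\cdots$ of pairwise commuting elements of $G$ that is bounded above in $G$ has a supremum $g$ in $G$, and $g\in CC(\{g_n:n\in\mathbb N\})$. An AH-algebra $G$ is always regarded as an archimedean partially ordered real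 vector space (it admits a compatible real vector space structure extending its ordered group structure, with $0\le\lambda$ and $0\le g$ implying $0\le\lambda g$; with the product $\frac12(gh+hg)$ it is a real Jordan algebra). **Notation in an AH-algebra.** For $0\leq g\in G$, $g^{1/2}$ is the unique element of $G$ with $0\leq g^{1/2}$ and $(g^{1/2})^2=g$ (it exists); $|g|:=(g^2)^{1/2}$ and $g^{+}:=\frac12(|g|+g)$ for any $g\in G$. The carrier projection $g^{\mathrm o}$ of $g\in G$ is the unique projection in $P$ such that for all $h\in G$, $gh=0\Leftrightarrow g^{\mathrm o}h=0$ (it exists). The $1$-norm on $G$ is $\|g\|:=\inf\{\lambda\in\mathbb R: 0\leq\lambda\text{ and }-\lambda\cdot 1\leq g\leq\lambda\cdot 1\}$. **Spectral notions.** For $g\in G$: $L_g:=\sup\{\lambda\in\mathbb R:\lambda\cdot 1\leq g\}$ and $U_g:=\inf\{\lambda\in\mathbb R: g\leq\lambda\cdot 1\}$ are the spectral lower and upper bounds (both finite, with $L_g\le U_g$). The spectral resolution of $g$ is the family of projections $p_\lambda:=1-((g-\lambda\cdot 1)^{+})^{\mathrm o}\in P$, $\lambda\in\mathbb R$. *)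

(* Defs.v *)
(* The directed group G of an e-ring (R, E) is a subset of R, so all products
   are products of R.  The real scalar multiplication of G is a function
   [smul : K -> R -> R] of which only the restriction to G is meaningful. *)
From HB Require Import structures.
From mathcomp Require Import all_boot all_order all_algebra.
From mathcomp Require Import classical_sets reals.

Set Implicit Arguments.
Unset Strict Implicit.
Unset Printing Implicit Defensive.

Import Order.TTheory GRing.Theory Num.Theory.

Local Open Scope classical_set_scope.
Local Open Scope ring_scope.

(* E^+; the empty sum is harmless since 0 is an effect. *)
Definition effect_sums (R : nzRingType) (E : set R) : set R :=
  [set a | exists s : seq R, (forall e, e \in s -> E e) /\ a = \sum_(e <- s) e].

Record e_ring (R : nzRingType) (E : set R) : Prop := {
  effect0 : E 0;
  effect1 : E 1;
  effect_compl : forall e, E e -> E (1 - e);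
  effect_sums_pointed : forall a,
    effect_sums E a -> effect_sums E (- a) -> a = 0;
  effect_sums_le1 : forall a,
    effect_sums E a -> effect_sums E (1 - a) -> E a;
  effect_sums_mul : forall a b, effect_sums E a -> effect_sums E b ->
    a * b = b * a -> effect_sums E (a * b);
  effect_sums_quad : forall a b, effect_sums E a -> effect_sums E b ->
    effect_sums E (a * b * a);
  effect_sums_quad0 : forall a b, effect_sums E a -> effect_sums E b ->
    a * b * a = 0 -> a * b = 0 /\ b * a = 0;
  effect_sums_sqr : forall a b, effect_sums E a -> effect_sums E b ->
    effect_sums E ((a - b) ^+ 2) }.

Definition dgroup (R : nzRingType) (E : set R) : set R :=
  [set g | exists a b, [/\ effect_sums E a, effect_sums E b & g = a - b]].

Definition dle (R : nzRingType) (E : set R) (g h : R) : Prop :=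
  effect_sums E (h - g).

Definition projections (R : nzRingType) (E : set R) : set R :=
  [set p | dgroup E p /\ p = p ^+ 2].

Definition commutant (R : nzRingType) (E A : set R) : set R :=
  [set g | dgroup E g /\ forall a, A a -> GRing.comm g a].

Definition bicommutant (R : nzRingType) (E A : set R) : set R :=
  commutant E (commutant E A).

Definition is_dsup (R : nzRingType) (E A : set R) (s : R) : Prop :=
  [/\ dgroup E s,
      forall a, A a -> dle E a s
    & forall b, dgroup E b -> (forall a, A a -> dle E a b) -> dle E s b].

Record ah_algebra (R : nzRingType) (E : set R) : Prop := {
  ah_half : exists2 e, E e & e + e = 1;
  ah_quadratic_annihilation : forall g h, dgroup E g -> dgroup E h ->
    g * h ^+ 2 * g = 0 -> g * h = 0 /\ h * g = 0;
  ah_commutative_Vigier : forall u : nat -> R,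
    (forall n, dgroup E (u n)) ->
    (forall n, dle E (u n) (u n.+1)) ->
    (forall m n, GRing.comm (u m) (u n)) ->
    (exists2 b, dgroup E b & forall n, dle E (u n) b) ->
    exists2 g, is_dsup E (range u) g & bicommutant E (range u) g }.

(* [smul] makes the ordered abelian group G a partially ordered real vector
   space.  In an AH-algebra G is archimedean, so there is at most one such
   scalar multiplication on G. *)
Record ordered_scaling (K : realType) (R : nzRingType) (E : set R)
    (smul : K -> R -> R) : Prop := {
  smul_closed : forall l g, dgroup E g -> dgroup E (smul l g);
  smulA : forall l m g, dgroup E g -> smul l (smul m g) = smul (l * m) g;
  smul1 : forall g, dgroup E g -> smul 1 g = g;
  smulDr : forall l g h, dgroup E g -> dgroup E h ->
    smul l (g + h) = smul l g + smul l h;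
  smulDl : forall l m g, dgroup E g -> smul (l + m) g = smul l g + smul m g;
  smul_ge0 : forall l g, dgroup E g -> 0 <= l -> dle E 0 g ->
    dle E 0 (smul l g) }.

(* g^{1/2}: for 0 <= g this set is a singleton in an AH-algebra. *)
Definition dsqrt (R : nzRingType) (E : set R) (g : R) : R :=
  xget 0 [set h | [/\ dgroup E h, dle E 0 h & h ^+ 2 = g]].

Definition dabs (R : nzRingType) (E : set R) (g : R) : R := dsqrt E (g ^+ 2).

Definition dpos (K : realType) (R : nzRingType) (E : set R)
    (smul : K -> R -> R) (g : R) : R :=
  smul 2^-1 (dabs E g + g).

(* g^o: for g in G this set is a singleton in an AH-algebra. *)
Definition carrier (R : nzRingType) (E : set R) (g : R) : R :=
  xget 0 [set p | projections E p /\
                  forall h, dgroup E h -> (g * h = 0 <-> p * h = 0)].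

Definition norm1 (K : realType) (R : nzRingType) (E : set R)
    (smul : K -> R -> R) (g : R) : K :=
  inf [set l : K | [/\ 0 <= l, dle E (smul (- l) 1) g & dle E g (smul l 1)]].

Definition spectral_lower (K : realType) (R : nzRingType) (E : set R)
    (smul : K -> R -> R) (g : R) : K :=
  sup [set l : K | dle E (smul l 1) g].

Definition spectral_upper (K : realType) (R : nzRingType) (E : set R)
    (smul : K -> R -> R) (g : R) : K :=
  inf [set l : K | dle E g (smul l 1)].

Definition spectral_resolution (K : realType) (R : nzRingType) (E : set R)
    (smul : K -> R -> R) (g : R) (l : K) : R :=
  1 - carrier E (dpos E smul (g - smul l 1)).

Definition mesh (K : realType) (n : nat) (lam : nat -> K) : K :=
  \big[Num.max/lam 1%N - lam 0%N]_(1 <= i < n.+1) (lam i - lam i.-1).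

(* Main.v *)
(* Commutative suprema do all the work.  Applied to -1/2^n the Vigier property
   makes G archimedean; applied to y' = (b + y^2)/2 it gives square roots,
   hence absolute values; applied to 1 - (1 - a)^n it gives carriers; applied
   to dyadic multiples of 1 it shows that real multiples of 1 commute with G.
   All of these commute with whatever commutes with the data.  For x = g - l
   the carrier q of x^+ then satisfies x q >= 0 and x (1 - q) <= 0, so that
   the p_l form an increasing family of projections in CC(g), and
   u = p_m - p_l satisfies l u <= g u <= m u; the estimate follows by summing
   over i, since the u_i add up to 1. *)
Require Import Defs.
From HB Require Import structures.
From mathcomp Require Import all_boot all_order all_algebra.
From mathcomp Require Import classical_sets reals.
From mathcomp Require Import ring.

Set Implicit Arguments.
Unset Strict Implicit.
Unset Printing Implicit Defensive.

Import Order.TTheory GRing.Theory Num.Theory.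

Local Open Scope classical_set_scope.
Local Open Scope ring_scope.

(** * Calculation with commuting elements *)

(** Induction on [s], starting from the integers: adjoining [u] replaces [S] by its polynomial ring,
    evaluated at [u]. Evaluation is a ring morphism because [u] commutes with the image of [S]; the
    last clause carries this through the induction. *)
Lemma comm_family (R : nzRingType) (s : seq R) :
  (forall x y, x \in s -> y \in s -> GRing.comm x y) ->
  exists (S : comNzRingType) (f : {rmorphism S -> R}),
    (forall x, x \in s -> exists a, f a = x) /\
    (forall z, (forall x, x \in s -> GRing.comm z x) ->
       forall a, GRing.comm z (f a)).
Proof.
elim: s => [|u s IH] cs.
  exists int, intr; split => // z _ a; exact: commr_int.
have [|S [f [surj cf]]] := IH.
  by move=> x y xs ys; apply: cs; rewrite inE ?xs ?ys orbT.
have cfu : commr_rmorph f u.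
  by move=> a; apply: cf => x xs; apply: cs; rewrite inE ?eqxx ?xs ?orbT.
exists {poly S}, (horner_morph cfu); split => [x|z cz p].
  rewrite inE => /predU1P[->|/surj[a <-]].
    by exists 'X; exact: horner_morphX.
  by exists a%:P; exact: horner_morphC.
have cza a : GRing.comm z (f a) by apply: cf => x xs; apply: cz; rewrite inE xs orbT.
have czu : GRing.comm z u by apply: cz; rewrite inE eqxx.
elim/poly_ind: p => [|p c IHp]; first by rewrite rmorph0; exact: commr0.
rewrite rmorphD rmorphM /= horner_morphX horner_morphC.
by apply: commrD => //; apply: commrM.
Qed.

(* Reduces identities between commuting elements of R to a commutative ring. *)
Lemma comm_family4 (R : nzRingType) (x y z w : R) :
  GRing.comm x y -> GRing.comm x z -> GRing.comm x w -> GRing.comm y z ->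
  GRing.comm y w -> GRing.comm z w ->
  exists (S : comNzRingType) (f : {rmorphism S -> R}) (a b c d : S),
    [/\ f a = x, f b = y, f c = z & f d = w].
Proof.
move=> xy xz xw yz yw zw.
have [|S [f [surj _]]] := @comm_family R [:: x; y; z; w].
  move=> s t; rewrite !inE => /or4P[]/eqP-> /or4P[]/eqP->;
  by [exact: commr_refl | exact: commr_sym |].
have [|a fa] := surj x; first by rewrite !inE eqxx.
have [|b fb] := surj y; first by rewrite !inE eqxx orbT.
have [|c fc] := surj z; first by rewrite !inE eqxx !orbT.
have [|d fd] := surj w; first by rewrite !inE eqxx !orbT.
by exists S, f, a, b, c, d.
Qed.

Create HintDb comm.

Ltac comm_right tac :=
  lazymatch goal with
  | |- GRing.comm _ (_ + _) => apply: commrD; tac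
  | |- GRing.comm _ (_ * _) => apply: commrM; tac
  | |- GRing.comm _ (- _) => apply: commrN; tac
  | |- GRing.comm _ (_ ^+ _) => apply: commrX; tac
  | |- GRing.comm _ (_ *+ _) => apply: commrMn; tac
  | |- GRing.comm _ 1 => exact: commr1
  | |- GRing.comm _ 0 => exact: commr0
  end.

Ltac comm_tac :=
  first [ assumption | apply: commr_sym; assumption | exact: commr_refl
        | comm_right comm_tac | apply: commr_sym; comm_right comm_tac
        | solve [eauto 3 with comm]].

(** Lifts a term of [R] built from images under [f] to a term of the commutative ring, where [ring]
    applies. *)
Ltac reify f t :=
  lazymatch t with
  | @GRing.RMorphism.sort _ _ f ?a => a
  | @Algebra.add _ ?u ?v => let a := reify f u in let b := reify f v in
      constr:(a + b)
  | @GRing.mul _ ?u ?v => let a := reify f u in let b := reify f v in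
      constr:(a * b)
  | @Algebra.opp _ ?u => let a := reify f u in constr:(- a)
  | @GRing.exp _ ?u ?n => let a := reify f u in constr:(a ^+ n)
  | @Algebra.natmul _ ?u ?n => let a := reify f u in constr:(a *+ n)
  | @GRing.one _ => let S := lazymatch type of f with
      | @GRing.RMorphism.type ?S _ => S end in constr:(1 : S)
  | @Algebra.zero _ => let S := lazymatch type of f with
      | @GRing.RMorphism.type ?S _ => S end in constr:(0 : S)
  end.

(* The four arguments must commute pairwise; repetitions are allowed. *)
Ltac comm_ring x y z w :=
  let S := fresh "S" in let f := fresh "f" in
  let a := fresh "a" in let b := fresh "b" in
  let c := fresh "c" in let d := fresh "d" in
  let E := fresh "E" in
  have [||||||S [f [a [b [c [d]]]]]] := @comm_family4 _ x y z w;
  [comm_tac | comm_tac | comm_tac | comm_tac | comm_tac | comm_tac | ];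
  case; do 4! (move=> <-);
  lazymatch goal with |- ?l = ?r =>
    let l' := reify f l in let r' := reify f r in
    have E : l' = r'; [ring |
     move/(congr1 f): E;
     rewrite ?(rmorphD, rmorphM, rmorphN, rmorphXn, rmorphMn, rmorph1, rmorph0);
     by []]
  end.

(** * The order and the products of the directed group *)

Section DirectedGroup.
Variables (R : nzRingType) (E : set R) (hE : e_ring E).
Local Notation Pos := (effect_sums E).
Local Notation G := (dgroup E).

Lemma pos0 : Pos 0.
Proof. by exists [::]; split=> //; rewrite big_nil. Qed.

Lemma effect_pos e : E e -> Pos e.
Proof.
by move=> Ee; exists [:: e]; rewrite big_seq1; split=> // x; rewrite inE => /eqP->.
Qed.

Lemma pos1 : Pos 1.
Proof. exact: effect_pos (effect1 hE). Qed.

Lemma posD a b : Pos a -> Pos b -> Pos (a + b).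
Proof.
move=> [s [Es ->]] [t [Et ->]]; exists (s ++ t); rewrite big_cat; split=> // x.
by rewrite mem_cat => /orP[/Es|/Et].
Qed.

Lemma posMn a n : Pos a -> Pos (a *+ n).
Proof.
move=> pa; elim: n => [|n IH]; first by rewrite mulr0n; exact: pos0.
by rewrite mulrS; exact: posD.
Qed.

Lemma posM a b : Pos a -> Pos b -> GRing.comm a b -> Pos (a * b).
Proof. exact: (effect_sums_mul hE). Qed.

Lemma posX a n : Pos a -> Pos (a ^+ n).
Proof.
move=> pa; elim: n => [|n IH]; first by rewrite expr0; exact: pos1.
by rewrite exprS; apply: posM => //; exact: commrX.
Qed.

Lemma pos_anti a : Pos a -> Pos (- a) -> a = 0.
Proof. exact: (effect_sums_pointed hE). Qed.

Lemma pos_trans b a c : Pos (b - a) -> Pos (c - b) -> Pos (c - a).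
Proof. by move=> ab bc; rewrite -(subrK b c) -addrA; exact: posD. Qed.

Lemma pos_dgroup a : Pos a -> G a.
Proof. by move=> pa; exists a, 0; rewrite subr0; split=> //; exact: pos0. Qed.

Lemma dgroup0 : G 0. Proof. exact/pos_dgroup/pos0. Qed.
Lemma dgroup1 : G 1. Proof. exact/pos_dgroup/pos1. Qed.

Lemma dgroupN a : G a -> G (- a).
Proof. by move=> [b [c [pb pc ->]]]; exists c, b; rewrite opprB. Qed.

Lemma dgroupD a b : G a -> G b -> G (a + b).
Proof.
move=> [b1 [c1 [pb pc ->]]] [b2 [c2 [pb2 pc2 ->]]]; exists (b1 + b2), (c1 + c2).
by split; [exact: posD | exact: posD | rewrite opprD addrACA].
Qed.

Lemma dgroupB a b : G a -> G b -> G (a - b).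
Proof. by move=> Ga Gb; apply: dgroupD => //; exact: dgroupN. Qed.

Lemma pos_sqr a : G a -> Pos (a ^+ 2).
Proof. by move=> [b [c [pb pc ->]]]; exact: (effect_sums_sqr hE). Qed.

(** Each effect is at most 1, so a sum of n effects is at most n. *)
Lemma pos_bounded a : Pos a -> exists n, Pos (n%:R - a).
Proof.
move=> [s [Es ->]]; exists (size s); elim: s Es => [_|x s IH Es].
  by rewrite big_nil subr0; exact: pos0.
rewrite big_cons mulrS opprD addrACA; apply: posD.
  by apply: effect_pos; apply: (effect_compl hE); apply: Es; rewrite inE eqxx.
by apply: IH => y ys; apply: Es; rewrite inE ys orbT.
Qed.

Lemma pos_natB m n : (m <= n)%N -> Pos (n%:R - m%:R).
Proof. by move=> mn; rewrite -natrB //; exact/posMn/pos1. Qed.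

Lemma pos_bounded_exp c a : (1 < c)%N -> Pos a -> exists k, Pos (c%:R ^+ k - a).
Proof.
move=> c1 /pos_bounded[n pn]; exists n; apply: pos_trans pn _.
by rewrite -natrX; apply: pos_natB; exact/ltnW/ltn_expl.
Qed.

(** Bounding both parts of a difference shows that 1 is an order unit of G. *)
Lemma dgroup_bounded a : G a -> exists n, Pos (n%:R - a) /\ Pos (a + n%:R).
Proof.
move=> [b [c [pb pc ->]]].
have [m pm] := pos_bounded pb; have [n pn] := pos_bounded pc.
exists (m + n)%N; split.
  have -> : (m + n)%:R - (b - c) = (m%:R - b) + (n%:R + c).
    by rewrite natrD opprB [c - b]addrC addrACA.
  by apply: posD => //; apply: posD => //; exact/posMn/pos1.
have -> : b - c + (m + n)%:R = (b + m%:R) + (n%:R - c).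
  by rewrite natrD addrACA [- c + _]addrC.
by apply: posD => //; apply: posD => //; exact/posMn/pos1.
Qed.

(** * Consequences of the Vigier property and of quadratic annihilation *)

Hypothesis hAH : ah_algebra E.

Lemma commutative_Vigier (u : nat -> R) b :
  (forall n, G (u n)) -> (forall n, Pos (u n.+1 - u n)) ->
  (forall m n, GRing.comm (u m) (u n)) ->
  G b -> (forall n, Pos (b - u n)) ->
  exists s, [/\ G s, forall n, Pos (s - u n),
    forall c, G c -> (forall n, Pos (c - u n)) -> Pos (c - s)
    & forall h, G h -> (forall n, GRing.comm h (u n)) -> GRing.comm h s].
Proof.
move=> Gu uS uC Gb ub.
have [|s [Gs sub ssup] [_ sC]] := ah_commutative_Vigier hAH Gu uS uC.
  by exists b.
exists s; split => // [n|c Gc cu|h Gh hu].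
- by apply: sub; exists n.
- by apply: ssup => // _ [n _ <-]; exact: cu.
- by apply/commr_sym/sC; split=> // _ [n _ <-]; exact: hu.
Qed.

Lemma quadratic_annihilation g h : G g -> G h -> g * h ^+ 2 * g = 0 ->
  g * h = 0 /\ h * g = 0.
Proof. exact: (ah_quadratic_annihilation hAH). Qed.

(** If g h = 0 then g h^2 g = 0, and quadratic annihilation is two-sided. *)
Lemma annihilation_sym g h : G g -> G h -> g * h = 0 -> h * g = 0.
Proof.
move=> Gg Gh gh0; have [] // := @quadratic_annihilation g h Gg Gh.
by rewrite expr2 mulrA gh0 !mul0r.
Qed.

Lemma sqr_eq0 g : G g -> g ^+ 2 = 0 -> g = 0.
Proof.
move=> Gg g0; have [] := @quadratic_annihilation g 1 Gg dgroup1.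
  by rewrite expr1n mulr1.
by rewrite mulr1.
Qed.

(** * The effect one half and the archimedean property *)

Variables (e : R) (Ee : E e) (ee : e + e = 1).

(** Both e x and x e equal e x e + e x e, so [e] is central in all of [R]. *)
Lemma half_comm x : GRing.comm e x.
Proof.
have eex : e * x * e + e * x * e = e * x by rewrite -mulrDr ee mulr1.
by rewrite /GRing.comm -eex -!mulrA -mulrDl ee mul1r.
Qed.
Hint Resolve half_comm : comm.
Hint Extern 1 (GRing.comm _ e) => apply: commr_sym; exact: half_comm : comm.

Lemma posH : Pos e. Proof. exact: effect_pos. Qed.

Lemma half_double (x : R) : e * (x + x) = x.
Proof. by rewrite mulrDr -mulrDl ee mul1r. Qed.

Lemma dbl_inj (x y : R) : x + x = y + y -> x = y.
Proof. by move=> xy; rewrite -(half_double x) xy half_double. Qed.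

Lemma half_exp (c d : nat) k : (c = 2 ^ d)%N -> (e ^+ d) ^+ k * c%:R ^+ k = 1.
Proof.
move=> ->; rewrite natrX -exprMn_comm; last first.
  exact/commr_sym/commrX/commr_sym/commrX/commr_nat.
rewrite -exprMn_comm; last exact: commr_nat.
by rewrite mulr_natr mulr2n ee !expr1n.
Qed.

Lemma dgroup_half x : G x -> G (e * x).
Proof.
move=> [b [c [pb pc ->]]]; exists (e * b), (e * c).
by split; rewrite ?mulrBr //; apply: posM; auto using posH, half_comm.
Qed.

(** Polarization: 2 a b = (a + b)^2 - a^2 - b^2, and squares are positive. *)
Lemma dgroupM a b : G a -> G b -> GRing.comm a b -> G (a * b).
Proof.
move=> Ga Gb ab.
have <- : e * ((a + b) ^+ 2 - a ^+ 2 - b ^+ 2) = a * b.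
  by rewrite -[RHS]half_double; congr (_ * _); comm_ring a b a b.
by apply/dgroup_half/dgroupB; [apply: dgroupB|];
  apply/pos_dgroup/pos_sqr => //; exact: dgroupD.
Qed.

(* A supremum s of the elements -1/2^n satisfies s <= 2s. *)
Lemma dgroup_archimedean a c :
  G a -> G c -> (forall n, Pos (c - a *+ n)) -> Pos (- a).
Proof.
move=> Ga Gc ac.
have pek k : Pos (e ^+ k) by exact/posX/posH.
have [m [cm _]] := dgroup_bounded Gc.
have [|k] := @pos_bounded_exp 2 m%:R isT; first exact/posMn/pos1.
move/(pos_trans cm) => {m cm}ck.
have ek j : e ^+ j * 2%:R ^+ j = 1 by have := @half_exp 2 1 j erefl; rewrite expr1.
(* Since 2^(j+k) a is at most c, hence at most 2^k, a is at most 2^-j. *)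
have an j : Pos (e ^+ j - a).
  have -> : e ^+ j - a = e ^+ (j + k) * ((2%:R ^+ k - c) + (c - a *+ 2 ^ (j + k))).
    rewrite addrA subrK mulrBr -[a *+ _]mulr_natl natrX mulrA ek mul1r.
    by rewrite exprD -mulrA ek mulr1.
  by apply: posM => //; [exact: posD | exact/commr_sym/commrX/commr_sym/half_comm].
have [|||||s [Gs us ssup _]] := @commutative_Vigier (fun j => - e ^+ j) 0.
- by move=> j; exact/dgroupN/pos_dgroup.
- move=> j; rewrite opprK addrC exprS.
  by rewrite -{1}[e ^+ j]mul1r -ee -mulrBl addrK -exprS.
- by move=> i j; comm_tac.
- exact: dgroup0.
- by move=> j; rewrite opprK add0r.
have ps : Pos s.
  rewrite -[s](addrK s); apply: ssup; first exact: dgroupD.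
  move=> j; have <- : (s - - e ^+ j.+1) + (s - - e ^+ j.+1) = s + s - - e ^+ j.
    by rewrite !opprK addrACA exprS -mulrDl ee mul1r.
  exact: posD.
have := ssup _ (dgroupN Ga) _; move/(_ _)/(posD ps); rewrite addrC subrK; apply=> j.
by rewrite opprK addrC.
Qed.

(** * Square roots and carriers *)

(* r = 1 - s, where s is the supremum of the iterates y of (b + y^2)/2 started
   at 0.  The defect w = (b + s^2)/2 - s is zero because n w <= y_n <= 1. *)
Lemma pos_sqrt_lt1 b : Pos b -> Pos (1 - b) -> exists r,
  [/\ Pos r, r ^+ 2 = 1 - b & forall h, G h -> GRing.comm h b -> GRing.comm h r].
Proof.
move=> pb b1.
pose y n := iter n (fun y => e * (b + y ^+ 2)) 0.
have yS n : y n.+1 = e * (b + y n ^+ 2) by [].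
have cy h n : GRing.comm h b -> GRing.comm h (y n).
  move=> hb; elim: n => [|n IH]; first exact: commr0.
  by rewrite yS; comm_tac.
have cyb n : GRing.comm (y n) b by apply/commr_sym/cy.
have cyy m n : GRing.comm (y m) (y n) by apply: cy.
have py n : Pos (y n).
  elim: n => [|n IH]; first exact: pos0.
  by rewrite yS; apply: posM; auto using posH, half_comm, posD, posX.
have py1 n : Pos (1 - y n).
  elim: n => [|n IH]; first by rewrite subr0; exact: pos1.
  have -> : 1 - y n.+1 = e * ((1 - b) + (1 - y n) * (1 + y n)).
    rewrite -{1}ee yS; have := cyb n; move: (y n) => z zb.
    by comm_ring e b z e.
  apply: posM; [exact: posH | | exact: half_comm].
  by apply: posD => //; apply: posM; [| apply: posD => //; exact: pos1 | comm_tac].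
have pyS n : Pos (y n.+1 - y n).
  elim: n => [|n IH]; first by rewrite [y 0]/= subr0.
  have -> : y n.+2 - y n.+1 = e * ((y n.+1 - y n) * (y n.+1 + y n)).
    rewrite yS [X in _ - X]yS; have := cyy n.+1 n; have := cyb n; have := cyb n.+1.
    move: (y n) (y n.+1) => z t *.
    by comm_ring e b z t.
  apply: posM; [exact: posH | | exact: half_comm].
  by apply: posM => //; [exact: posD | move: (cyy n.+1 n) => *; comm_tac].
have [|s [Gs us ssup sC]] := @commutative_Vigier y 1 _ pyS cyy dgroup1 py1.
  by move=> n; exact: pos_dgroup.
have cs h : G h -> GRing.comm h b -> GRing.comm h s.
  by move=> Gh hb; apply: sC => // n; exact: cy.
have ps : Pos s by have := us 0%N; rewrite subr0.
have s1 : Pos (1 - s) by apply: ssup => //; exact: dgroup1.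
have sb : GRing.comm s b by apply/commr_sym/cs => //; exact: pos_dgroup.
have sy n : GRing.comm s (y n) by exact: cy.
pose w := e * (b + s ^+ 2) - s.
have pb2 : Pos (e * (b + s ^+ 2)).
  by apply: posM; auto using posH, half_comm, posD, posX.
have Gw : G w by apply: dgroupB => //; exact: pos_dgroup.
(* Every iterate is at most (b + s^2)/2, and s is the least upper bound. *)
have pw : Pos w.
  apply: ssup; first exact: pos_dgroup.
  case=> [|n]; first by rewrite subr0.
  have -> : e * (b + s ^+ 2) - y n.+1 = e * ((s - y n) * (s + y n)).
    rewrite yS; have := sy n; have := cyb n; move: (y n) => z *.
    by comm_ring e b s z.
  apply: posM; [exact: posH | | exact: half_comm].
  by apply: posM => //; [exact: posD | move: (sy n) => *; comm_tac].
have yw n : Pos (y n - w *+ n).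
  elim: n => [|n IH]; first by rewrite mulr0n subr0; exact: pos0.
  have -> : y n.+1 - w *+ n.+1 =
      (y n - w *+ n) + e * ((s - y n) * ((1 - s) + (1 - y n))).
    rewrite mulrS opprD addrA [RHS]addrAC; congr (_ - _).
    (* The vanishing term with factor 1 - (e + e) makes the identity hold for a free variable [e],
       as [ring] cannot use [ee]. *)
    transitivity (y n + e * ((s - y n) * ((1 - s) + (1 - y n))) +
        (1 - (e + e)) * (s - y n)); last by rewrite ee subrr mul0r addr0.
    rewrite yS /w; have := sy n; have := cyb n; move: (y n) => z *.
    by comm_ring e b s z.
  apply: posD => //; apply: posM; [exact: posH | | exact: half_comm].
  by apply: posM => //; [exact: posD | move: (sy n) => *; comm_tac].
have w0 : w = 0.
  apply: pos_anti => //; apply: dgroup_archimedean Gw dgroup1 _ => n.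
  exact: pos_trans (yw n) _.
(* w = 0 means 2 s = b + s^2, that is, (1 - s)^2 = 1 - b. *)
exists (1 - s); split=> //; last first.
  by move=> h Gh hb; move: (cs h Gh hb) => *; comm_tac.
have bs : b + s ^+ 2 = s + s.
  move/eqP: w0; rewrite subr_eq0 => /eqP w0.
  by rewrite -[LHS]mul1r -ee mulrDl w0.
have -> : (1 - s) ^+ 2 = 1 - b + ((b + s ^+ 2) - (s + s)) by comm_ring s b s b.
by rewrite bs subrr addr0.
Qed.

Lemma half_exp_pos k : Pos (e ^+ k).
Proof. exact/posX/posH. Qed.

Lemma halfX_comm k (x : R) : GRing.comm (e ^+ k) x.
Proof. exact/commr_sym/commrX/commr_sym/half_comm. Qed.

Lemma half_exp2 k : e ^+ k * 2%:R ^+ k = 1.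
Proof. by have := @half_exp 2 1 k erefl; rewrite expr1. Qed.

Lemma pos_scale_lt1 a : Pos a -> exists k, Pos (e ^+ k * a) /\ Pos (1 - e ^+ k * a).
Proof.
move=> pa; have [//|k pk] := @pos_bounded_exp 2 a isT _; exists k.
split; first exact: posM (half_exp_pos k) pa (halfX_comm _ _).
by rewrite -(half_exp2 k) -mulrBr; exact: posM (half_exp_pos k) pk (halfX_comm _ _).
Qed.

(** Dividing a by a large 4^k brings it into the unit interval; the root found there is multiplied
    by 2^k. *)
Lemma pos_sqrt a : Pos a -> exists r,
  [/\ Pos r, r ^+ 2 = a & forall h, G h -> GRing.comm h a -> GRing.comm h r].
Proof.
move=> pa; have [//|k pk] := @pos_bounded_exp 4 a isT _.
have ek : (e ^+ 2) ^+ k * 4%:R ^+ k = 1 by exact: half_exp.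
have ekc x : GRing.comm ((e ^+ 2) ^+ k) x by rewrite -exprM; exact: halfX_comm.
have pek : Pos ((e ^+ 2) ^+ k) by rewrite -exprM; exact: half_exp_pos.
have [||r [pr r2 rC]] := @pos_sqrt_lt1 (1 - (e ^+ 2) ^+ k * a).
- by rewrite -ek -mulrBr; exact: posM.
- by rewrite subKr; exact: posM.
exists (2%:R ^+ k * r); split.
- apply: posM => //; first exact/posX/posMn/pos1.
  exact/commr_sym/commrX/commr_nat.
- rewrite exprMn_comm; last exact/commr_sym/commrX/commr_nat.
  by rewrite r2 subKr mulrA -exprM mulnC exprM -natrX -ekc ek mul1r.
- move=> h Gh ha; apply: commrM; first exact/commrX/commr_nat.
  apply: rC => //; apply: commrB; first exact: commr1.
  by apply: commrM => //; exact/commr_sym.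
Qed.

(** With d = h - r, the positive elements d^2 h and d^2 r add up to d (h^2 - r^2) = 0, so both
    vanish. Then d^3 = 0, hence d^4 = 0, and squares in G vanish only at 0. *)
Lemma pos_sqrt_unique h r : Pos h -> Pos r -> GRing.comm h r ->
  h ^+ 2 = r ^+ 2 -> h = r.
Proof.
move=> ph pr hr h2.
have Gd : G (h - r) by apply: dgroupB; exact: pos_dgroup.
have pd : Pos ((h - r) ^+ 2) by exact: pos_sqr.
have ph' : Pos ((h - r) ^+ 2 * h) by apply: posM => //; comm_tac.
have pr' : Pos ((h - r) ^+ 2 * r) by apply: posM => //; comm_tac.
have hr0 : (h - r) ^+ 2 * h + (h - r) ^+ 2 * r = 0.
  have -> : (h - r) ^+ 2 * h + (h - r) ^+ 2 * r = (h - r) * (h ^+ 2 - r ^+ 2).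
    by comm_ring h r h r.
  by rewrite h2 subrr mulr0.
have h0 : (h - r) ^+ 2 * h = 0.
  apply: pos_anti => //.
  by move/eqP: hr0; rewrite addr_eq0 => /eqP ->; rewrite opprK.
have r0 : (h - r) ^+ 2 * r = 0 by rewrite h0 add0r in hr0.
have /(sqr_eq0 (pos_dgroup pd))/(sqr_eq0 Gd)/eqP : ((h - r) ^+ 2) ^+ 2 = 0.
  have d3 : (h - r) ^+ 2 * (h - r) = 0 by rewrite mulrBr h0 r0 subrr.
  by rewrite [LHS]expr2 [X in _ * X]expr2 mulrA d3 mul0r.
by rewrite subr_eq0 => /eqP.
Qed.

(** Existence rules out the default of [xget]. The chosen root h commutes with h^2 = a, hence with
    the constructed root r, so uniqueness among commuting roots identifies them. *)
Lemma dsqrtP a : Pos a -> [/\ Pos (dsqrt E a), dsqrt E a ^+ 2 = a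
  & forall h, G h -> GRing.comm h a -> GRing.comm h (dsqrt E a)].
Proof.
move=> pa; have [r [pr r2 rC]] := pos_sqrt pa.
rewrite /dsqrt; case: xgetP => [_ -> [Gh ph h2]|/(_ r)[]]; last first.
  by split; [exact: pos_dgroup | rewrite /dle subr0 | ].
move: (xget _ _) Gh ph h2 => h Gh; rewrite /dle subr0 => ph h2.
suff -> : h = r by [].
apply: pos_sqrt_unique => //; last by rewrite h2.
by apply: rC => //; rewrite -h2; exact/commrX/commr_refl.
Qed.

(** * Carrier projections *)

(** Scale c to some d at most 1. As d u_n = 0, the element p (1 - d) - u_n = (p - u_n) (1 - d) is
    positive, so p (1 - d) is still an upper bound; hence p is at most p - d p, and d p = 0. *)
Lemma pos_annihilates_sup (u : nat -> R) p c : Pos p ->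
  (forall d, G d -> (forall n, Pos (d - u n)) -> Pos (d - p)) ->
  (forall n, Pos (p - u n)) -> Pos c -> GRing.comm c p ->
  (forall n, GRing.comm c (u n)) -> (forall n, c * u n = 0) -> c * p = 0.
Proof.
move=> pp psup up pc cp cu cu0.
have [k [pd d1]] := pos_scale_lt1 pc.
set d := e ^+ k * c in pd d1.
have dC x : GRing.comm c x -> GRing.comm d x.
  by move=> cx; apply/commr_sym/commrM; apply: commr_sym => //; exact: halfX_comm.
have pdp : Pos (d * p) by apply: posM => //; exact: dC.
suff d0 : d * p = 0.
  move/(congr1 ( *%R (2%:R ^+ k))): d0; rewrite mulr0 !mulrA.
  by rewrite -[2%:R ^+ k * _]halfX_comm half_exp2 mul1r.
apply: pos_anti => //.
have -> : - (d * p) = p * (1 - d) - p.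
  by rewrite mulrBr mulr1 -(dC p cp) addrAC subrr add0r.
apply: psup => [|n].
  apply/pos_dgroup/posM => //; apply: commrB; first exact: commr1.
  exact/commr_sym/dC.
have -> : p * (1 - d) - u n = (p - u n) * (1 - d).
  rewrite [RHS]mulrBl [u n * _]mulrBr -[u n * d](dC _ (cu n)) -[d * _]mulrA cu0.
  by rewrite mulr0 subr0 mulr1.
apply: posM => //; apply: commrB; first exact: commr1.
by apply/commr_sym/commrB; apply: dC.
Qed.

(* p is the supremum of u_n = 1 - (1 - a)^n, and q = 1 - p annihilates a because
   n q a <= u_n <= 1. *)
Lemma carrier_lt1_exists a : Pos a -> Pos (1 - a) -> exists p,
  [/\ projections E p, forall h, G h -> (a * h = 0 <-> p * h = 0)
    & forall h, G h -> GRing.comm h a -> GRing.comm h p].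
Proof.
move=> pa pb; set b := 1 - a in pb.
have ab : GRing.comm a b by rewrite /b; comm_tac.
pose u n := 1 - b ^+ n.
have uC h n : GRing.comm h a -> GRing.comm h (u n).
  by move=> ha; rewrite /u /b; comm_tac.
have [|||||p [Gp up psup pC]] := @commutative_Vigier u 1.
- by move=> n; apply: dgroupB; [exact: dgroup1 | exact/pos_dgroup/posX].
- move=> n; have -> : u n.+1 - u n = b ^+ n * a.
    rewrite /u opprB addrAC addrCA subrr addr0 exprSr -{1}[b ^+ n]mulr1 -mulrBr.
    by rewrite /b subKr.
  by apply: posM => //; [exact: posX | comm_tac].
- by move=> m n; apply/uC/commr_sym/uC/commr_refl.
- exact: dgroup1.
- by move=> n; rewrite /u subKr; exact: posX.
have pC' h : G h -> GRing.comm h a -> GRing.comm h p.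
  by move=> Gh ha; apply: pC => // n; exact: uC.
have ap : GRing.comm a p by apply: pC' => //; exact: pos_dgroup.
have pp : Pos p by have := up 0%N; rewrite /u expr0 subrr subr0.
have pq : Pos (1 - p).
  by apply: psup => [|n]; [exact: dgroup1 | rewrite /u subKr; exact: posX].
set q := 1 - p in pq.
have qa : GRing.comm q a by rewrite /q; comm_tac.
have qp : GRing.comm q p by rewrite /q; comm_tac.
have pqa : Pos (q * a) by exact: posM.
have qa0 : q * a = 0.
  apply: pos_anti => //; apply: (dgroup_archimedean (pos_dgroup pqa) dgroup1) => n.
  suff pn : Pos (u n - (q * a) *+ n).
    by apply: pos_trans pn _; rewrite /u subKr; exact: posX.
  elim: n => [|n IH]; first by rewrite /u expr0 subrr mulr0n subr0; exact: pos0.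
  have -> : u n.+1 - (q * a) *+ n.+1 = (u n - (q * a) *+ n) + (p - u n) * a.
    rewrite mulrS opprD addrA [RHS]addrAC; congr (_ - _).
    have bn : GRing.comm (b ^+ n) a by comm_tac.
    have bp : GRing.comm (b ^+ n) p by rewrite /b; comm_tac.
    rewrite /u exprSr {2}/b /q; move: (b ^+ n) bn bp => z za zp.
    by comm_ring a p z a.
  apply: posD => //; apply: posM => //; move: (uC a n (commr_refl _)) => *; comm_tac.
(* q a = 0 gives q b = q, so q annihilates every u_n and therefore their supremum p; this makes p
   idempotent. *)
have qu0 n : q * u n = 0.
  suff qb : q * b ^+ n = q by rewrite /u mulrBr qb mulr1 subrr.
  elim: n => [|n IH]; first by rewrite expr0 mulr1.
  by rewrite exprSr mulrA IH /b mulrBr mulr1 qa0 subr0.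
have qu n : GRing.comm q (u n) by exact: uC.
have qp0 : q * p = 0 by exact: (pos_annihilates_sup pp psup up).
have p2 : p = p ^+ 2.
  by apply/eqP; rewrite -subr_eq0 expr2 -{1}[p]mul1r -mulrBl qp0.
have apE : a * p = a.
  by apply/eqP; rewrite eq_sym -subr_eq0 -{1}[a]mulr1 -mulrBr -/q -qa qa0.
exists p; split=> // h Gh; split=> [ah0|ph0]; last by rewrite -apE -mulrA ph0 mulr0.
have ha0 := annihilation_sym (pos_dgroup pa) Gh ah0.
have ha : GRing.comm h a by rewrite /GRing.comm ah0.
have hp := pC' h Gh ha.
(* h need not be positive, so the supremum argument is run on h^2; quadratic annihilation then
   recovers p h = 0. *)
have h2p : h ^+ 2 * p = 0.
  apply: (pos_annihilates_sup pp psup up) => [|||n].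
  - exact: pos_sqr.
  - by comm_tac.
  - by move=> n; move: (uC h n ha) => *; comm_tac.
  suff hb : h * b ^+ n = h by rewrite /u expr2 -mulrA mulrBr mulr1 hb subrr mulr0.
  elim: n => [|n IH]; first by rewrite expr0 mulr1.
  by rewrite exprSr mulrA IH /b mulrBr mulr1 ha0 subr0.
by have [] := @quadratic_annihilation p h Gp Gh _; rewrite // -mulrA h2p mulr0.
Qed.

Lemma carrier_exists a : Pos a -> exists p,
  [/\ projections E p, forall h, G h -> (a * h = 0 <-> p * h = 0)
    & forall h, G h -> GRing.comm h a -> GRing.comm h p].
Proof.
move=> /pos_scale_lt1[k [pk k1]].
have [p [Pp ph pC]] := carrier_lt1_exists pk k1.
exists p; split=> // [h Gh|h Gh ha].
  rewrite -ph //; split=> [ah0|]; first by rewrite -mulrA ah0 mulr0.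
  move/(congr1 ( *%R (2%:R ^+ k))); rewrite mulr0 -mulrA mulrA.
  by rewrite -[2%:R ^+ k * _]halfX_comm half_exp2 mul1r.
by apply: pC => //; apply: commrM => //; exact/commr_sym/halfX_comm.
Qed.

Lemma proj_compl p : projections E p -> projections E (1 - p).
Proof.
move=> [Gp p2]; split; first by apply: dgroupB => //; exact: dgroup1.
by rewrite expr2 mulrBr mulr1 mulrBl mul1r -expr2 -p2 subrr subr0.
Qed.

Lemma proj_pos p : projections E p -> Pos p.
Proof. by move=> [Gp ->]; exact: pos_sqr. Qed.

(** p and q annihilate the same elements of G, among them 1 - p and 1 - q. This gives q = q p and,
    after exchanging factors, p = q p. *)
Lemma carrier_unique a p q : projections E p -> projections E q ->
  (forall h, G h -> (a * h = 0 <-> p * h = 0)) ->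
  (forall h, G h -> (a * h = 0 <-> q * h = 0)) -> p = q.
Proof.
move=> Pp Pq ap aq; have [Gp p2] := Pp; have [Gq q2] := Pq.
have [G1p _] := proj_compl Pp; have [G1q _] := proj_compl Pq.
have qp0 : q * (1 - p) = 0.
  by apply/(aq _ G1p)/(ap _ G1p); rewrite mulrBr mulr1 -expr2 -p2 subrr.
have /(annihilation_sym Gp G1q) : p * (1 - q) = 0.
  by apply/(ap _ G1q)/(aq _ G1q); rewrite mulrBr mulr1 -expr2 -q2 subrr.
move/eqP; rewrite mulrBl mul1r subr_eq0 => /eqP ->.
by move/eqP: qp0; rewrite mulrBr mulr1 subr_eq0 => /eqP.
Qed.

Lemma carrierP a : Pos a -> [/\ projections E (carrier E a),
  forall h, G h -> (a * h = 0 <-> carrier E a * h = 0)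
  & forall h, G h -> GRing.comm h a -> GRing.comm h (carrier E a)].
Proof.
move=> /carrier_exists[p [Pp ph pC]]; rewrite /carrier.
case: xgetP => [_ -> [Pq qh]|/(_ p)[]] //.
by move: (xget _ _) Pq qh => q Pq qh; rewrite (carrier_unique Pq Pp qh ph).
Qed.

(* If p is the carrier of (b + y)^2 then p y = p b, so that b + y = 2 p b. *)
Lemma pos_add_of_sqr b y : Pos b -> G y -> GRing.comm b y -> b ^+ 2 = y ^+ 2 ->
  Pos (b + y).
Proof.
move=> pb Gy yb b2; have Gb := pos_dgroup pb.
have Gby : G (b + y) by exact: dgroupD.
have [p [Pp ph pC]] := carrier_exists (pos_sqr Gby); have [Gp p2] := Pp.
have bp : GRing.comm b p by apply: pC => //; comm_tac.
have yp : GRing.comm y p by apply: pC => //; comm_tac.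
have pby : p * (b - y) = 0.
  apply/ph; first exact: dgroupB.
  have -> : (b + y) ^+ 2 * (b - y) = (b + y) * (b ^+ 2 - y ^+ 2) by comm_ring b y b y.
  by rewrite b2 subrr mulr0.
have [G1p _] := proj_compl Pp.
(* The carrier only controls (b + y)^2; quadratic annihilation removes the square. *)
have by1p : (b + y) * (1 - p) = 0.
  apply: (proj2 (quadratic_annihilation G1p Gby _)).
  rewrite -mulrA (_ : (b + y) ^+ 2 * (1 - p) = 0) ?mulr0 //.
  by apply/ph => //; rewrite mulrBr mulr1 -expr2 -p2 subrr.
have -> : b + y = p * b + p * b.
  have -> : b + y = (b + y) * (1 - p) - p * (b - y) + (p * b + p * b).
    by comm_ring b y p b.
  by rewrite by1p pby subrr add0r.
have ppb : Pos (p * b) by apply: posM => //; exact: proj_pos.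
exact: posD.
Qed.

Lemma dabsP x : G x -> [/\ Pos (dabs E x), dabs E x ^+ 2 = x ^+ 2,
  forall h, G h -> GRing.comm h x -> GRing.comm h (dabs E x),
  Pos (dabs E x + x) & Pos (dabs E x - x)].
Proof.
move=> Gx; have [pb b2 bC] := dsqrtP (pos_sqr Gx).
rewrite -/(dabs E x) in pb b2 bC *.
have {}bC h : G h -> GRing.comm h x -> GRing.comm h (dabs E x).
  by move=> Gh hx; apply: bC => //; exact: commrX.
have bx : GRing.comm (dabs E x) x by exact/commr_sym/bC/commr_refl.
split=> //; first exact: pos_add_of_sqr.
by apply: pos_add_of_sqr; rewrite ?sqrrN //; [exact: dgroupN | exact: commrN].
Qed.

(** * Real scalars *)

Variables (K : realType) (smul : K -> R -> R) (hsmul : ordered_scaling E smul).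

Lemma smul0l g : G g -> smul 0 g = 0.
Proof.
move=> Gg; have := smulDl hsmul 0 0 Gg; rewrite addr0 => /eqP.
by rewrite -subr_eq0 opprD addrA subrr add0r oppr_eq0 => /eqP.
Qed.

Lemma smulNl l g : G g -> smul (- l) g = - smul l g.
Proof.
by move=> Gg; apply/eqP; rewrite -addr_eq0 -(smulDl hsmul) // addNr smul0l.
Qed.

Lemma smulBl l m g : G g -> smul (l - m) g = smul l g - smul m g.
Proof. by move=> Gg; rewrite (smulDl hsmul) // smulNl. Qed.

Lemma smul0r l : smul l 0 = 0.
Proof.
have := smulDr hsmul l dgroup0 dgroup0; rewrite addr0 => /eqP.
by rewrite -subr_eq0 opprD addrA subrr add0r oppr_eq0 => /eqP.
Qed.

Lemma smulNr l g : G g -> smul l (- g) = - smul l g.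
Proof.
move=> Gg; apply/eqP; rewrite -addr_eq0 -(smulDr hsmul) ?addNr ?smul0r //.
exact: dgroupN.
Qed.

Lemma smulMnl n g : G g -> smul n%:R g = g *+ n.
Proof.
move=> Gg; elim: n => [|n IH]; first exact: smul0l.
by rewrite mulrS (smulDl hsmul) // IH (smul1 hsmul) // mulrS.
Qed.

Lemma smul_pos l g : 0 <= l -> Pos g -> Pos (smul l g).
Proof.
move=> l0 pg; have := smul_ge0 hsmul (pos_dgroup pg) l0.
by rewrite /dle !subr0; exact.
Qed.

Lemma smul_le l m g : l <= m -> Pos g -> Pos (smul m g - smul l g).
Proof.
move=> lm pg; rewrite -smulBl; last exact: pos_dgroup.
by apply: smul_pos; rewrite ?subr_ge0.
Qed.

Lemma smul_half g : G g -> smul 2^-1 g = e * g.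
Proof.
move=> Gg; apply: dbl_inj; rewrite -(smulDl hsmul) // -mulrDl ee mul1r.
by rewrite -[RHS](smul1 hsmul) //; congr smul; rewrite [RHS](splitr 1) mul1r.
Qed.

Lemma smul_half_exp k g : G g -> smul (2^-1 ^+ k) g = e ^+ k * g.
Proof.
move=> Gg; elim: k => [|k IH]; first by rewrite !expr0 mul1r (smul1 hsmul).
rewrite !exprS -(smulA hsmul) // IH smul_half ?mulrA //.
by apply: dgroupM => //; [exact/pos_dgroup/half_exp_pos | exact: halfX_comm].
Qed.

Lemma dyadic_approx (l : K) k : 0 <= l ->
  (Num.trunc (l * 2 ^+ k))%:R * 2^-1 ^+ k <= l <=
    (Num.trunc (l * 2 ^+ k))%:R * 2^-1 ^+ k + 2^-1 ^+ k.
Proof.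
move=> l0.
have /andP[tl lt] := truncn_itv (mulr_ge0 l0 (exprn_ge0 k (ler0n K 2))).
rewrite exprVn ler_pdivrMr ?exprn_gt0 // tl /= -[X in _ + X]mul1r -mulrDl natr1.
by rewrite ler_pdivlMr ?exprn_gt0 // ltW.
Qed.

(** The bound at k = n already gives that n a is at most c, because n is at most 2^n. *)
Lemma dyadic_archimedean a c : G a -> Pos c -> (forall k, Pos (e ^+ k * c - a)) ->
  Pos (- a).
Proof.
move=> Ga pc ac; apply: (dgroup_archimedean Ga (pos_dgroup pc)) => n.
have -> : c - a *+ n = (2%:R ^+ n - n%:R) * (e ^+ n * c) + (e ^+ n * c - a) *+ n.
  rewrite mulrBl mulrA -[_ * e ^+ n]halfX_comm half_exp2 mul1r mulrnBl mulr_natl.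
  by rewrite addrA subrK.
apply: posD; last exact: posMn.
apply: posM; first by rewrite -natrX; apply: pos_natB; exact/ltnW/ltn_expl.
  exact: posM (half_exp_pos n) pc (halfX_comm _ _).
by apply: commr_sym; apply: commrB; [rewrite -natrX|]; exact: commr_nat.
Qed.

(** Dyadic scalars act through [smul] as multiplication by central elements of [R]; other scalars
    are reached by squeezing between [q k] and [q k + d k]. *)
Lemma dyadic_approx_smul l : 0 <= l -> exists (m : nat -> nat) (q d : nat -> K),
  [/\ forall k, q k <= l, forall k, l <= q k + d k, forall k, q k <= q k.+1,
     forall k g, G g -> smul (q k) g = (m k)%:R * (e ^+ k * g)
   & forall k g, G g -> smul (d k) g = e ^+ k * g].
Proof.
move=> l0.
exists (fun k => Num.trunc (l * 2 ^+ k)),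
  (fun k => (Num.trunc (l * 2 ^+ k))%:R * 2^-1 ^+ k), (fun k => 2^-1 ^+ k).
split=> [k|k|k|k g Gg|k g Gg]; last exact: smul_half_exp.
- by have /andP[] := dyadic_approx k l0.
- by have /andP[] := dyadic_approx k l0.
(* Twice the integer part of l 2^k is at most the integer part of l 2^(k+1). *)
- rewrite [2^-1 ^+ k.+1]exprS mulrA ler_pM2r ?exprn_gt0 ?invr_gt0 //.
  rewrite ler_pdivlMr // -natrM ler_nat.
  rewrite truncn_ge_nat ?mulr_ge0 ?exprn_ge0 // natrM exprSr mulrA ler_pM2r //.
  by have /andP[] := truncn_itv (mulr_ge0 l0 (exprn_ge0 k (ler0n K 2))).
rewrite -(smulA hsmul) // smul_half_exp // smulMnl ?mulr_natl //.
by apply: dgroupM => //; [exact/pos_dgroup/half_exp_pos | exact: halfX_comm].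
Qed.

(* l 1 is the supremum of dyadic multiples of 1, which are central in R. *)
Lemma smul1_comm_ge0 l h : 0 <= l -> G h -> GRing.comm h (smul l 1).
Proof.
move=> l0 Gh; have G1 := dgroup1; have p1 := pos1.
have [m [q [d [ql lq qS qE dE]]]] := dyadic_approx_smul l0.
have hq x k : GRing.comm x (smul (q k) 1).
  rewrite qE // mulr1.
  by apply: commrM; [exact: commr_nat | exact/commr_sym/halfX_comm].
have Gl x : G (smul x 1) by exact: (smul_closed hsmul).
have [|||||s [Gs us ssup sC]] :=
  @commutative_Vigier (fun k => smul (q k) 1) (smul l 1) => //.
- by move=> k; exact: smul_le.
- by move=> k; exact: smul_le.
suff -> : smul l 1 = s by exact: sC.
apply/eqP; rewrite -subr_eq0; apply/eqP/pos_anti.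
  by apply: ssup => // k; exact: smul_le.
apply: (@dyadic_archimedean _ 1) => //; first exact: dgroupB.
move=> k; rewrite -dE // opprB addrA.
have -> : smul (d k) 1 + s - smul l 1 =
   (s - smul (q k) 1) + (smul (q k + d k) 1 - smul l 1).
  by rewrite (smulDl hsmul) // !addrA subrK [s + _]addrC.
by apply: posD => //; exact: smul_le.
Qed.

Lemma smul1_comm l h : G h -> GRing.comm h (smul l 1).
Proof.
move=> Gh; have [l0|l0] := leP 0 l; first exact: smul1_comm_ge0.
rewrite -[l]opprK smulNl; last exact: dgroup1.
by apply/commrN/smul1_comm_ge0; rewrite // oppr_ge0 ltW.
Qed.

(** The two sides agree at dyadic scalars and are monotone in l, so they differ by at most h / 2^k
    in either direction, for every k. *)
Lemma smulE_pos l h : 0 <= l -> Pos h -> smul l h = smul l 1 * h.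
Proof.
move=> l0 ph; have Gh := pos_dgroup ph; have G1 := dgroup1; have p1 := pos1.
have cl m : GRing.comm (smul m 1) h by exact/commr_sym/smul1_comm.
have Gl x : G (smul x 1) by exact: (smul_closed hsmul).
have [m [q [d [ql lq _ qE dE]]]] := dyadic_approx_smul l0.
have qM k : smul (q k) 1 * h = smul (q k) h by rewrite !qE // mulr1 mulrA.
have dM k : smul (d k) 1 * h = smul (d k) h by rewrite !dE // mulr1.
have Gd : G (smul l h - smul l 1 * h).
  by apply: dgroupB; [exact: (smul_closed hsmul) | exact: dgroupM].
have p1h x y : x <= y -> Pos ((smul y 1 - smul x 1) * h).
  move=> xy; apply: posM => //; first exact: smul_le.
  by apply/commr_sym/commrB; exact: smul1_comm.
apply/eqP; rewrite -subr_eq0; apply/eqP/pos_anti; last first.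
  apply: (dyadic_archimedean Gd ph) => k; rewrite -dE //.
  have -> : smul (d k) h - (smul l h - smul l 1 * h) =
     (smul (q k + d k) h - smul l h) + (smul l 1 - smul (q k) 1) * h.
    rewrite (smulDl hsmul) // mulrBl qM.
    move: (smul l h) (smul (q k) h) (_ * h) (smul (d k) h) => B Q C a.
    by rewrite opprB [RHS]addrC -(addrA Q) [RHS]addrA subrK addrCA.
  by apply: posD; [exact: smul_le | exact: p1h].
rewrite -(opprK (smul l h - smul l 1 * h)).
apply: (dyadic_archimedean (dgroupN Gd) ph) => k.
rewrite opprK -dE //.
have -> : smul (d k) h + (smul l h - smul l 1 * h) =
     (smul l h - smul (q k) h) + (smul (q k + d k) 1 - smul l 1) * h.
  rewrite mulrBl (smulDl hsmul) // mulrDl qM dM.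
  move: (smul l h) (smul (q k) h) (smul l 1 * h) (smul (d k) h) => B Q C a.
  by rewrite !addrA subrK [B + _]addrC.
by apply: posD; [exact: smul_le | exact: p1h].
Qed.

Lemma smulE l h : G h -> smul l h = smul l 1 * h.
Proof.
have key m g : 0 <= m -> G g -> smul m g = smul m 1 * g.
  move=> m0 [a [b [pa pb ->]]]; have Gb := pos_dgroup pb.
  rewrite (smulDr hsmul) ?smulNr //; last exact: dgroupN; last exact: pos_dgroup.
  by rewrite mulrBr (smulE_pos m0 pa) (smulE_pos m0 pb).
move=> Gh; have [l0|l0] := leP 0 l; first exact: key.
rewrite -[l]opprK !(@smulNl (- l)) //; last exact: dgroup1.
have nl : 0 <= - l by rewrite oppr_ge0 ltW.
by rewrite (key _ _ nl Gh) mulNr.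
Qed.

(** * The spectral resolution *)

(** The carrier q of x^+ annihilates |x| - x, since (|x| + x) (|x| - x) = |x|^2 - x^2 = 0, while 1 -
    q is annihilated by |x| + x. So x acts as |x| on q and as -|x| on 1 - q. *)
Lemma carrier_dposP x : G x -> let q := carrier E (dpos E smul x) in
  [/\ projections E q, forall h, G h -> GRing.comm h x -> GRing.comm h q,
      Pos (x * q) & Pos (- (x * (1 - q)))].
Proof.
move=> Gx q; have [pb b2 bC pbx pbNx] := dabsP Gx.
have Gbx := pos_dgroup pbx.
have xE : dpos E smul x = e * (dabs E x + x) by rewrite /dpos smul_half.
have pxe : Pos (e * (dabs E x + x)) by exact: posM posH pbx (half_comm _).
have := carrierP pxe; rewrite -xE -/q xE => -[Pq qh qC].
have qxC h : G h -> GRing.comm h x -> GRing.comm h q.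
  move=> Gh hx; apply: qC => //; move: (bC h Gh hx) => hb.
  by apply: commrM; [exact/commr_sym/half_comm | exact: commrD].
have bx : GRing.comm (dabs E x) x by exact/commr_sym/bC/commr_refl.
have qb : GRing.comm (dabs E x) q by apply: qxC => //; exact: pos_dgroup.
have xq : GRing.comm x q by exact: qxC.
have [G1q _] := proj_compl Pq; have [Gq q2] := Pq.
have qbx : q * (dabs E x - x) = 0.
  apply/qh; first exact: pos_dgroup.
  rewrite -mulrA.
  have -> : (dabs E x + x) * (dabs E x - x) = dabs E x ^+ 2 - x ^+ 2.
    by move: (dabs E x) bx => b bx; comm_ring b x b x.
  by rewrite b2 subrr mulr0.
have bxq : (dabs E x + x) * (1 - q) = 0.
  have ebx : e * (dabs E x + x) * (1 - q) = 0.
    by apply/(qh _ G1q); rewrite mulrBr mulr1 -expr2 -q2 subrr.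
  by rewrite -[LHS]half_double mulrDr mulrA ebx addr0.
have p1q := proj_pos (proj_compl Pq); have pq := proj_pos Pq.
split=> //.
- have -> : x * q = dabs E x * q.
    rewrite xq qb; apply/eqP; rewrite eq_sym -subr_eq0 -mulrBr; exact/eqP.
  exact: posM.
- have -> : - (x * (1 - q)) = dabs E x * (1 - q).
    by apply/eqP; rewrite eq_sym -subr_eq0 opprK -mulrDl bxq.
  by apply: posM => //; comm_tac.
Qed.

(** * Order and commutation of the spectral projections *)

Variables (g : R) (Gg : G g).
Local Notation p := (spectral_resolution E smul g).

Lemma smul1_dgroup l : G (smul l 1).
Proof. by apply: (smul_closed hsmul); exact: dgroup1. Qed.

Lemma spectral_resolutionP l : [/\ projections E (p l),
  forall h, G h -> GRing.comm h g -> GRing.comm h (p l),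
  Pos ((smul l 1 - g) * p l) & Pos ((g - smul l 1) * (1 - p l))].
Proof.
have Gx : G (g - smul l 1) by apply: dgroupB => //; exact: smul1_dgroup.
have [Pq qC pxq pxq1] := carrier_dposP Gx; rewrite /spectral_resolution.
split; first exact: proj_compl.
- move=> h Gh hg; apply: commrB; first exact: commr1.
  by apply: qC => //; apply: commrB => //; exact: smul1_comm.
- by rewrite -opprB mulNr.
- by rewrite subKr.
Qed.

(** t r is both positive and negative, hence 0, and t is invertible. Contradictory bounds for g on a
    projection thus force that projection to vanish. *)
Lemma smul_lt0_pos t r : t < 0 -> Pos r -> Pos (smul t r) -> r = 0.
Proof.
move=> t0 pr ptr; have Gr := pos_dgroup pr.
have tr0 : smul t r = 0.
  apply: pos_anti => //; rewrite -smulNl //.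
  by apply: smul_pos; rewrite ?oppr_ge0 ?ltW.
rewrite -[r](smul1 hsmul) // -(@mulVf _ t) ?lt_eqF // -(smulA hsmul) // tr0.
exact: smul0r.
Qed.

Lemma spectral_resolution_comm l m : GRing.comm (p l) (p m).
Proof.
have [[Gl _] lC _ _] := spectral_resolutionP l.
have [_ mC _ _] := spectral_resolutionP m.
by apply: mC => //; apply/commr_sym/lC.
Qed.

(** On r = p_l (1 - p_m) one has both g r at most l r and g r at least m r, so (l - m) r is positive
    although l < m. *)
Lemma spectral_resolution_mul l m : l < m -> p l * p m = p l.
Proof.
move=> lm; have [Pl lC gl _] := spectral_resolutionP l.
have [Pm mC _ gm] := spectral_resolutionP m.
have cl h : GRing.comm (p h) (smul l 1).
  by apply: smul1_comm; case: (spectral_resolutionP h) => -[].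
have cm h : GRing.comm (p h) (smul m 1).
  by apply: smul1_comm; case: (spectral_resolutionP h) => -[].
have gpl : GRing.comm g (p l) by exact: lC.
have gpm : GRing.comm g (p m) by exact: mC.
have plm := spectral_resolution_comm l m.
have gcl := smul1_comm l Gg; have gcm := smul1_comm m Gg.
have p1m := proj_pos (proj_compl Pm); have pl := proj_pos Pl.
have pr : Pos (p l * (1 - p m)) by apply: posM => //; comm_tac.
apply/eqP; rewrite eq_sym -subr_eq0 -{1}[p l]mulr1 -mulrBr; apply/eqP.
apply: (@smul_lt0_pos (l - m)) => //; first by rewrite subr_lt0.
rewrite smulE; last exact: pos_dgroup.
rewrite smulBl; last exact: dgroup1.
have -> : (smul l 1 - smul m 1) * (p l * (1 - p m)) =
    ((smul l 1 - g) * p l) * (1 - p m) + ((g - smul m 1) * (1 - p m)) * p l.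
  have c : GRing.comm (p l) (1 - p m) by comm_tac.
  by rewrite -2!mulrA -c -mulrDl addrA subrK.
apply: posD; apply: posM => //.
  move: (cl l) (cl m) => *; comm_tac.
move: (cm l) (cm m) => *; comm_tac.
Qed.

(** On p_l, g is at most l, against the global lower bound m > l. *)
Lemma spectral_resolution_eq0 l m : l < m -> Pos (g - smul m 1) -> p l = 0.
Proof.
move=> lm gm; have [Pl lC gl _] := spectral_resolutionP l; have [Gp _] := Pl.
have cm := smul1_comm m Gp; have gp : GRing.comm g (p l) by exact: lC.
have pl := proj_pos Pl.
apply: (@smul_lt0_pos (l - m)) => //; first by rewrite subr_lt0.
rewrite smulE // smulBl; last exact: dgroup1.
rewrite -(subrK g (smul l 1)) -addrA mulrDl.
by apply: posD => //; apply: posM => //; comm_tac.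
Qed.

(** On 1 - p_l, g is at least l, against the global upper bound m < l. *)
Lemma spectral_resolution_eq1 l m : m < l -> Pos (smul m 1 - g) -> p l = 1.
Proof.
move=> ml gm; have [Pl lC _ gl] := spectral_resolutionP l; have [Gp _] := Pl.
have cm := smul1_comm m Gp; have gp : GRing.comm g (p l) by exact: lC.
have pl := proj_pos (proj_compl Pl).
apply/eqP; rewrite eq_sym -subr_eq0; apply/eqP.
apply: (@smul_lt0_pos (m - l)) => //; first by rewrite subr_lt0.
rewrite smulE; last exact: pos_dgroup.
rewrite smulBl; last exact: dgroup1.
rewrite -(subrK g (smul m 1)) -addrA mulrDl.
by apply: posD => //; apply: posM => //; comm_tac.
Qed.

(** * Spectral bounds *)

Lemma lt_spectral_lower l : l < spectral_lower E smul g ->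
  exists2 m, l < m & Pos (g - smul m 1).
Proof.
move=> lL; have [|m gm lm] := @sup_gt _ _ l _ lL; last by exists m.
have [n [_ gn]] := dgroup_bounded Gg; exists (- n%:R).
by rewrite /= /dle smulNl ?smulMnl ?opprK //; exact: dgroup1.
Qed.

Lemma spectral_upper_lt l : spectral_upper E smul g < l ->
  exists2 m, m < l & Pos (smul m 1 - g).
Proof.
move=> lL; have [|m gm lm] := @inf_lt _ _ l _ lL; last by exists m.
have [n [gn _]] := dgroup_bounded Gg; exists n%:R.
by rewrite /= /dle smulMnl //; exact: dgroup1.
Qed.

(** Covers n = 1, where no node lies between the spectral bounds: m at most l would give b < a,
    whereas a 1 is below g and g below b 1, forcing 1 = 0. *)
Lemma smul1_le_lt l m a b : l < a -> b < m ->
  Pos (g - smul a 1) -> Pos (smul b 1 - g) -> l < m.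
Proof.
move=> la bm ga gb; rewrite ltNge; apply/negP => ml.
have ba : b - a < 0.
  by rewrite subr_lt0; exact: lt_le_trans bm (le_trans ml (ltW la)).
have pba : Pos (smul (b - a) 1).
  by rewrite smulBl; [exact: pos_trans ga gb | exact: dgroup1].
by move: (smul_lt0_pos ba pos1 pba) => /eqP; rewrite oner_eq0.
Qed.

(** * Increments of the resolution and the norm *)

(** u = p_m (1 - p_l) is a product of commuting projections; the factor p_m gives the upper bound m
    for g on u, and 1 - p_l the lower bound l. *)
Lemma spectral_step l m : l < m -> let u := p m - p l in
  [/\ projections E u, bicommutant E [set g] u,
   Pos ((smul m 1 - g) * u) & Pos ((g - smul l 1) * u)].
Proof.
move=> lm u; have [Pl lC _ gl] := spectral_resolutionP l.
have [Pm mC gm _] := spectral_resolutionP m.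
have [Gl l2] := Pl; have [Gm m2] := Pm.
have clm := spectral_resolution_mul lm.
have cml : p m * p l = p l by rewrite -spectral_resolution_comm.
have Gu : G u by exact: dgroupB.
have uC h : G h -> GRing.comm h g -> GRing.comm h u.
  by move=> Gh hg; apply: commrB; [exact: mC | exact: lC].
have um : u = p m * (1 - p l) by rewrite mulrBr mulr1 cml.
have ul : u = (1 - p l) * p m by rewrite mulrBl mul1r clm.
have pm := proj_pos Pm; have p1l := proj_pos (proj_compl Pl).
have gpl : GRing.comm g (p l) by exact: lC.
have gpm : GRing.comm g (p m) by exact: mC.
have plm := spectral_resolution_comm l m.
split.
- by split=> //; rewrite expr2 {3}um mulrA [u * p m]mulrBl clm
    -expr2 -m2 mulrBl -um mulrBr mulr1 -expr2 -l2 subrr subr0.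
- split=> // h [Gh hg]; apply/commr_sym/uC => //; exact: (hg g).
- rewrite um mulrA; move: (smul1_comm m Gl) (smul1_comm m Gm) => *.
  by apply: posM => //; comm_tac.
- rewrite ul mulrA; move: (smul1_comm l Gl) (smul1_comm l Gm) => *.
  by apply: posM => //; comm_tac.
Qed.

Lemma norm1_le eps x : 0 <= eps -> Pos (smul eps 1 - x) ->
  Pos (smul eps 1 + x) -> norm1 E smul x <= eps.
Proof.
move=> e0 xe ex; apply: ge_inf; first by exists 0 => y [].
by split=> //; rewrite /dle smulNl ?opprK 1?addrC //; exact: dgroup1.
Qed.

Lemma pos_sum (n : nat) (F : nat -> R) :
  (forall i, (1 <= i <= n)%N -> Pos (F i)) -> Pos (\sum_(1 <= i < n.+1) F i).
Proof.
move=> pF; rewrite big_nat.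
by apply: (big_ind Pos); [exact: pos0 | exact: posD | exact: pF].
Qed.

(** The two elements are (m - g) u + (eps - (m - c)) u and (g - l) u + (eps - (c - l)) u, whose
    scalar coefficients are nonnegative because c lies between l and m. *)
Lemma spectral_step_near l m c eps : l < m -> l <= c <= m -> m - l <= eps ->
  let u := p m - p l in
  Pos (smul eps u - (g * u - smul c u)) /\ Pos (smul eps u + (g * u - smul c u)).
Proof.
move=> lm /andP[lc cm] mle u; have [Pu _ um ul] := spectral_step lm.
have pu := proj_pos Pu; have Gu := pos_dgroup pu.
rewrite -/u in um ul pu Gu.
have emc : 0 <= eps - (m - c) by rewrite subr_ge0 (le_trans _ mle) // lerB.
have ecl : 0 <= eps - (c - l) by rewrite subr_ge0 (le_trans _ mle) // lerB.
split.
- have -> : smul eps u - (g * u - smul c u) =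
      (smul m 1 - g) * u + smul (eps - (m - c)) u.
    rewrite !smulBl // mulrBl -smulE // !opprB.
    by rewrite [RHS]addrCA; congr (_ + _); rewrite [RHS]addrC [RHS]addrA subrK.
  by apply: posD => //; exact: smul_pos.
- have -> : smul eps u + (g * u - smul c u) =
      (g - smul l 1) * u + smul (eps - (c - l)) u.
    rewrite !smulBl // mulrBl -smulE // !opprB.
    by rewrite [RHS]addrCA; congr (_ + _); rewrite [RHS]addrA subrK.
  by apply: posD => //; exact: smul_pos.
Qed.

End DirectedGroup.

(** * Summation over the partition *)

Lemma mesh_ge (K : realType) n (lam : nat -> K) i : (1 <= i <= n)%N ->
  lam i - lam i.-1 <= mesh n lam.
Proof.
move=> i1n; rewrite /mesh.
by apply: (@le_bigmax_seq _ _ _ _ _ i xpredT (fun i => lam i - lam i.-1));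
  rewrite ?mem_index_iota.
Qed.

Theorem theorem7p7 (K : realType) (R : nzRingType) (E : set R)
    (smul : K -> R -> R)
    (hE : e_ring E) (hAH : ah_algebra E) (hsmul : ordered_scaling E smul)
    (g : R) (hg : dgroup E g)
    (n : nat) (hn : (1 <= n)%N) (lam gamma : nat -> K)
    (hL : lam 0%N < spectral_lower E smul g)
    (hU : spectral_upper E smul g < lam n)
    (hLU : forall i : nat, (0 < i < n)%N ->
       spectral_lower E smul g < lam i < spectral_upper E smul g)
    (hlam : forall i : nat, (0 < i)%N -> (i.+1 < n)%N -> lam i < lam i.+1)
    (hgamma : forall i : nat, (1 <= i <= n)%N ->
       lam i.-1 <= gamma i <= lam i) :
  let p := spectral_resolution E smul g in
  let u := fun i : nat => p (lam i) - p (lam i.-1) in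
  [/\ forall i : nat, (1 <= i <= n)%N ->
        (projections E `&` bicommutant E [set g]) (u i),
      \sum_(1 <= i < n.+1) u i = 1
    & norm1 E smul (g - \sum_(1 <= i < n.+1) smul (gamma i) (u i))
        <= mesh n lam].
Proof.
move=> p u; have [e Ee ee] := ah_half hAH.
have [a la ga] := lt_spectral_lower hE hsmul hg hL.
have [b bn gb] := spectral_upper_lt hE hsmul hg hU.
(* The first two nodes are separated by L, the last two by U, the inner ones by [hlam]; n = 1 needs
   the witnesses a and b. *)
have lamS i : (1 <= i <= n)%N -> lam i.-1 < lam i.
  case: i => //= i ilen.
  have [->|i0] := posnP i.
    have [n1|n1] := ltnP 1 n.
      by apply: (lt_trans hL); case/andP: (hLU 1%N n1).
    have <- : n = 1%N by apply/eqP; rewrite eqn_leq n1.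
    exact (smul1_le_lt hE hsmul la bn ga gb).
  have [iSn|nS] := ltnP i.+1 n; first exact: hlam.
  have ni : i.+1 = n by apply/eqP; rewrite eqn_leq ilen nS.
  rewrite ni; apply: (lt_trans _ hU).
  by have /andP[] : spectral_lower E smul g < lam i < spectral_upper E smul g
    by apply: hLU; rewrite i0 -ni ltnSn.
have sum1 : \sum_(1 <= i < n.+1) u i = 1.
  (* After the index shift the sum telescopes to p at the last node minus p at the first, which is 1
     - 0. *)
  rewrite big_add1 /= telescope_sumr // /p.
  rewrite (spectral_resolution_eq1 hE hAH Ee ee hsmul hg bn gb).
  by rewrite (spectral_resolution_eq0 hE hAH Ee ee hsmul hg la ga) subr0.
have step i (i1n : (1 <= i <= n)%N) :=
  spectral_step hE hAH Ee ee hsmul hg (lamS i i1n).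
have near i (i1n : (1 <= i <= n)%N) :=
  spectral_step_near hE hAH Ee ee hsmul hg (lamS i i1n) (hgamma i i1n)
    (mesh_ge lam i1n).
have Gu i : (1 <= i <= n)%N -> dgroup E (u i) by case/step => -[].
split=> //; first by move=> i /step[Pu Cu _ _].
(* As the u_i add up to 1, both g and the mesh times 1 split along them, which reduces the norm
   bound to one inequality per increment. *)
have sumE : g - \sum_(1 <= i < n.+1) smul (gamma i) (u i) =
    \sum_(1 <= i < n.+1) (g * u i - smul (gamma i) (u i)).
  by rewrite sumrB -mulr_sumr sum1 mulr1.
have epsE : smul (mesh n lam) 1 = \sum_(1 <= i < n.+1) smul (mesh n lam) (u i).
  rewrite -[LHS]mulr1 -[X in _ * X]sum1 mulr_sumr [LHS]big_nat [RHS]big_nat.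
  by apply: eq_bigr => i i1n; rewrite [RHS](smulE hE hAH Ee ee hsmul _ (Gu i i1n)).
have mesh0 : 0 <= mesh n lam.
  apply: le_trans (@mesh_ge K n lam 1%N _); rewrite ?hn //.
  by rewrite subr_ge0 ltW // lamS // hn.
rewrite sumE; apply: (norm1_le hE hsmul) => //; rewrite epsE.
  by rewrite -sumrB; apply: pos_sum => i i1n; case: (near i i1n).
by rewrite -big_split; apply: pos_sum => i i1n; case: (near i i1n).
Qed.
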